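(* Let $t,\ell,k,d$ be positive integers. Let $G$ be a graph having an $H$-partition of layered width at most $\ell$ in which $H$ has treewidth at most $t$, and let $\mathcal{P}$ be a $(k,d)$-shortcut system for $G$. Then $G^{\mathcal{P}}$ has a $J$-partition of layered width at most $d\ell(k^3+3k)$ for some graph $J$ of treewidth at most $\binom{k+t}{t}-1$.
   Context: A layering of a graph $G$ is a sequence $\langle L_0,L_1,\ldots\rangle$ of sets partitioning $V(G)$ such that for every edge $vw$ with $v\in L_i$, $w\in L_j$ we have $|i-j|\leq 1$. For a partition $\{S_x : x\in V(H)\}$ of $V(G)$ indexed by the vertices of a graph $H$, it is an $H$-partition if $H$ is the quotient graph: $xy\in E(H)$ iff $x\neq y$ and there is an edge $vw\in E(G)$ with $v\in S_x$, $w\in S_y$. The layered width of a partition $\mathcal{S}$ with respect to a layering $\mathcal{L}$ is $\max\{|L\cap S|: L\in\mathcal{L}, S\in\mathcal{S}\}$; the layered width of $\mathcal{S}$ is the minimum of this over all layerings of $G$. A non-empty set $\mathcal{P}$ of paths of length at least 1 in $G$ is a $(k,d)$-shortcut system if every path has length (number of edges) at most $k$ and each vertex of $G$ is an internal vertex of at most $d$ paths in $\mathcal{P}$. $G^{\mathcal{P}}$ is the supergraph of $G$ obtained by adding the edge $vw$ for each path in $\mathcal{P}$ with endpoints $v,w$. *)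

(* Defs.v *)
From mathcomp Require Import all_boot.
Set Implicit Arguments. Unset Strict Implicit. Unset Printing Implicit Defensive.

Definition sgraph (T : finType) (e : rel T) : Prop :=
  symmetric e /\ irreflexive e.

Definition is_tree (I : finType) (tr : rel I) : Prop :=
  sgraph tr /\ 0 < #|I| /\ (forall i j : I, connect tr i j) /\
  ~ (exists s : seq I, [&& 3 <= size s, uniq s & cycle tr s]).

Definition tree_decomposition (V : finType) (e : rel V)
    (I : finType) (tr : rel I) (B : I -> {set V}) : Prop :=
  is_tree tr /\
  (forall v : V, exists i : I, v \in B i) /\
  (forall v w : V, e v w -> exists i : I, (v \in B i) && (w \in B i)) /\
  (forall v : V, forall i j : I, v \in B i -> v \in B j ->
     connect [rel a b | [&& tr a b, v \in B a & v \in B b]] i j).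

Definition treewidth_le (V : finType) (e : rel V) (w : nat) : Prop :=
  exists (I : finType) (tr : rel I) (B : I -> {set V}),
    tree_decomposition e tr B /\ forall i : I, #|B i| <= w.+1.

Definition layering (T : finType) (e : rel T) (lay : T -> nat) : Prop :=
  forall v w : T, e v w -> (lay v <= (lay w).+1) && (lay w <= (lay v).+1).

(* f : V(G) -> V(H) describes the partition {S_x := f^-1(x) : x in V(H)};
   it is an H-partition: all parts nonempty (f surjective) and H is the quotient. *)
Definition is_H_partition (T : finType) (e : rel T) (X : finType) (eH : rel X)
    (f : T -> X) : Prop :=
  (forall x : X, exists v : T, f v = x) /\
  (forall x y : X, eH x y <-> (x != y /\ exists v w : T, [/\ f v = x, f w = y & e v w])).

Definition layered_width_le (T : finType) (e : rel T) (X : finType) (f : T -> X)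
    (l : nat) : Prop :=
  exists lay : T -> nat, layering e lay /\
    forall (i : nat) (x : X), #|[set v | (lay v == i) && (f v == x)]| <= l.

(* A path in G, given by its vertex sequence; its length is size p - 1. *)
Definition is_gpath (T : finType) (e : rel T) (p : seq T) : Prop :=
  match p with
  | [::] => False
  | x :: q => uniq p /\ path e x q
  end.

Definition internal (T : Type) (p : seq T) : seq T := drop 1 (take (size p).-1 p).

Definition shortcut_system (T : finType) (e : rel T) (k d : nat) (P : seq (seq T)) : Prop :=
  P != [::] /\ uniq P /\
  (forall p, p \in P -> is_gpath e p /\ 2 <= size p <= k.+1) /\
  (forall v : T, count (fun p => v \in internal p) P <= d).

Definition ends_at (T : eqType) (p : seq T) (v w : T) : bool :=
  match p with
  | [::] => false
  | x :: q => ((x == v) && (last x q == w)) || ((x == w) && (last x q == v))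
  end.

Definition shortcut_graph (T : finType) (e : rel T) (P : seq (seq T)) : rel T :=
  fun v w => e v w || has (fun p => ends_at p v w) P.

(* Main.v *)
(* A tree decomposition of H of width t yields a perfect elimination order: every
   vertex of H gets at most t up-neighbours, which form a clique and decide every
   edge. Let up k x be the set of vertices reached from x by at most k up-steps;
   it has at most C(k+t, t) elements. Move each vertex v of G to the topmost part
   met by v and by the interiors of the shortcuts ending at v. The new part of v is
   at most k-1 up-steps above the old one, so the two new parts of an edge of G are
   both within k up-steps of the lower old part, and the two new parts of a shortcut
   are both within k up-steps of the topmost part met by its interior. Hence the sets
   up k x are the bags of a tree decomposition of the new quotient. For the width,
   merge k consecutive layers: a vertex moved into a part S is the end of one of the
   at most d shortcuts through some vertex of S in one of three merged layers. *)

Require Import Defs.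
From mathcomp Require Import all_boot zify.

Set Implicit Arguments. Unset Strict Implicit. Unset Printing Implicit Defensive.

Lemma card_bigcup_le (I : Type) (T : finType) (r : seq I) (A : pred I) (F : I -> {set T}) :
  #|\bigcup_(i <- r | A i) F i| <= \sum_(i <- r | A i) #|F i|.
Proof.
elim/big_rec2: _ => [|i n S _ leSn]; first by rewrite cards0.
by rewrite (leq_trans (leq_card_setU _ _)) // leq_add2l.
Qed.

(* [N x c] reads "c is an up-neighbour of x": ranks decrease towards the roots. *)
Definition elimination_order (X : finType) (rk : X -> nat) (N : rel X) : Prop :=
  [/\ injective rk,
      forall x c, N x c -> rk c < rk x &
      forall x c c', N x c -> N x c' -> rk c' < rk c -> N c c'].

(** * Reachability by up-steps in an elimination order *)

Section UpReach.

Variables (X : finType) (rk : X -> nat) (N : rel X).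
Hypothesis elimN : elimination_order rk N.

Let rk_inj : injective rk. Proof. by case: elimN. Qed.
Let rk_up x c : N x c -> rk c < rk x. Proof. by case: elimN => _ + _; apply. Qed.
Let up_clique x c c' : N x c -> N x c' -> rk c' < rk c -> N c c'.
Proof. by case: elimN => _ _; apply. Qed.

Fixpoint up (k : nat) (x : X) : {set X} :=
  if k is k'.+1 then x |: \bigcup_(c | N x c) up k' c else [set x].

Lemma up_refl k x : x \in up k x.
Proof. by case: k => [|k] /=; rewrite !inE ?eqxx. Qed.

Lemma upSP k x b :
  reflect (b = x \/ exists2 c, N x c & b \in up k c) (b \in up k.+1 x).
Proof.
rewrite /= !inE; apply: (iffP orP) => -[].
- by move/eqP; left.
- by case/bigcupP=> c Nxc bc; right; exists c.
- by move->; left.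
- by case=> c Nxc bc; right; apply/bigcupP; exists c.
Qed.

Lemma up_step k x c b : N x c -> b \in up k c -> b \in up k.+1 x.
Proof. by move=> Nxc bc; apply/upSP; right; exists c. Qed.

Lemma up_mono j k x b : j <= k -> b \in up j x -> b \in up k x.
Proof.
elim: j k x => [|j IH] k x; first by move=> _; rewrite inE => /eqP->; exact: up_refl.
case: k => [//|k] le_jk /upSP[->|[c Nxc bc]]; first exact: up_refl.
by apply: up_step Nxc _; apply: IH bc.
Qed.

Lemma up_rk k x b : b \in up k x -> rk b <= rk x.
Proof.
elim: k x => [|k IH] x; first by rewrite inE => /eqP->.
case/upSP=> [->//|[c Nxc /IH bc]].
exact: leq_trans bc (ltnW (rk_up Nxc)).
Qed.

Lemma up_trans j k x y z : y \in up j x -> z \in up k y -> z \in up (j + k) x.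
Proof.
elim: j x => [|j IH] x; first by rewrite inE => /eqP->.
rewrite addSn; case/upSP=> [->|[c Nxc yc] zy].
  by apply: up_mono; rewrite -addSn leq_addl.
by apply: up_step Nxc _; apply: IH.
Qed.

(** If the first up-step goes from [x] to [d], then [c] and [d] are both up-neighbours of [x], so
    the upper of the two is an up-neighbour of the other. When [d] is above [c], step from [c] to
    [d] instead; when [c] is above [d], recurse at [d]. *)
Lemma up_neighbour k x c b :
  N x c -> b \in up k x -> rk b <= rk c -> b \in up k c.
Proof.
elim: k x => [|k IH] x Nxc.
  rewrite inE => /eqP-> le_xc.
  by move: (leq_trans (rk_up Nxc) le_xc); rewrite ltnn.
case/upSP=> [->|[d Nxd bd]] le_bc.
  by move: (leq_trans (rk_up Nxc) le_bc); rewrite ltnn.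
case: (ltngtP (rk c) (rk d)) => [lt_cd|lt_dc|/rk_inj eq_cd].
- by apply: (@up_mono k); rewrite // (IH d) // (up_clique Nxd Nxc).
- exact: up_step (up_clique Nxc Nxd lt_dc) bd.
- by rewrite eq_cd; apply: up_mono bd.
Qed.

(** [up_neighbour] is applied at each vertex on the way from [x] to [c]; none of them is above
    [b]. *)
Lemma up_between j k x c b :
  c \in up j x -> b \in up k x -> rk b <= rk c -> b \in up k c.
Proof.
elim: j x => [|j IH] x; first by rewrite inE => /eqP->.
case/upSP=> [->//|[y Nxy cy] bx le_bc].
apply: (IH y) => //; apply: (up_neighbour Nxy bx).
exact: leq_trans le_bc (up_rk cy).
Qed.

Definition weak_step (x y : X) := [|| x == y, N x y | N y x].

(** A step up from [x] to [y] costs one up-step. A step down costs none: [x] is then an up-neighbour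
    of [y] and not above the end of the walk, so [up_neighbour] applies. *)
Lemma up_walk x s :
  path weak_step x s -> {in x :: s, forall y, rk (last x s) <= rk y} ->
  last x s \in up (size s) x.
Proof.
elim: s x => [|y s IH] x; first by rewrite inE.
rewrite [path _ _ _]/= => /andP[xy pys] min_last.
have lasty : last y s \in up (size s) y.
  by apply: IH => // z zs; apply: (min_last z); rewrite inE zs orbT.
case/or3P: xy => [/eqP<-|Nxy|Nyx] in lasty *.
- exact: up_mono (leqnSn _) lasty.
- exact: up_step lasty.
- apply: (@up_mono (size s)) => //.
  by apply: up_neighbour lasty (min_last x _) => //; rewrite inE eqxx.
Qed.

(* The topmost up-neighbour [c] of [x] above the threshold splits [up k x]: what is
   not below [c] lies in [up k.-1 c], and what is strictly below [c] has [c] as an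
   up-neighbour, so that moving the threshold past [c] saves one neighbour. *)
Lemma card_up_above t k n x :
  (forall z, z \in up k x -> #|[set c | N z c & n <= rk c]| <= t) ->
  #|[set b in up k x | n <= rk b]| <= 'C(k + t, t).
Proof.
elim: t k n x => [|t IHt] k.
  elim: k => [|k IHk] n x szN.
    rewrite bin0 -(cards1 x) subset_leq_card //; apply/subsetP=> b.
    by rewrite !inE => /andP[].
  rewrite bin0 -(cards1 x) subset_leq_card //; apply/subsetP=> b.
  rewrite inE => /andP[/upSP[->|[c Nxc bc]] nb]; first by rewrite inE.
  have := szN x (up_refl _ _); rewrite leqn0 cards_eq0 => /eqP/setP/(_ c).
  by rewrite !inE Nxc (leq_trans nb (up_rk bc)).
elim: k => [|k IHk] n x szN.
  rewrite add0n binn -(cards1 x) subset_leq_card //; apply/subsetP=> b.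
  by rewrite !inE => /andP[].
case: (pickP [pred c | N x c & n <= rk c]) => [c0 c0P|noc]; last first.
  apply: (@leq_trans 1); last by rewrite bin_gt0 leq_addl.
  rewrite -(cards1 x) subset_leq_card //; apply/subsetP=> b.
  rewrite inE => /andP[/upSP[->|[c Nxc bc]] nb]; first by rewrite inE.
  by have := noc c; rewrite inE Nxc (leq_trans nb (up_rk bc)).
case: (arg_minnP rk c0P) => c /andP[Nxc nc] minc.
(* By the clique property, [c] stays an up-neighbour of every vertex met on the way up to a vertex
   strictly below [c]. *)
have low_N j z : z \in up j x -> rk c < rk z -> N z c.
  have: z \in up j x -> rk c < rk z -> z = x \/ N z c.
    elim: j x Nxc {szN c0P minc} => [|j IH] y Nyc.
      by rewrite inE => /eqP->; left.
    case/upSP=> [->|[d Nyd zd] lt_cz]; first by left.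
    have Ndc : N d c.
      by apply: up_clique Nyd Nyc _; apply: leq_trans lt_cz (up_rk zd).
    by case: (IH d Ndc zd lt_cz) => [->|]; right.
  by move=> H zx cz; case: (H zx cz) => [->|].
have sub : [set b in up k.+1 x | n <= rk b] \subset
    [set b in up k c | n <= rk b] :|: [set b in up k.+1 x | (rk c).+1 <= rk b].
  apply/subsetP=> b; rewrite in_set => /andP[bx nb]; apply/setUP.
  case: (ltnP (rk c) (rk b)) => [lt_cb|le_bc]; first by right; rewrite in_set bx.
  left; rewrite in_set nb andbT.
  case/upSP: bx => [eq_bx|[d Nxd bd]].
    by move: (rk_up Nxc); rewrite -eq_bx ltnNge le_bc.
  case: (ltngtP (rk c) (rk d)) => [lt_cd|lt_dc|/rk_inj->//].
    exact: up_neighbour (up_clique Nxd Nxc lt_cd) bd le_bc.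
  have := minc d; rewrite /= Nxd (leq_trans nb (up_rk bd)) => /(_ isT).
  by rewrite leqNgt lt_dc.
rewrite (leq_trans (subset_leq_card sub)) //.
(* Pascal's rule splits the bound like the set: [k] drops for what [c] reaches, [t] drops for what
   lies strictly below [c]. *)
rewrite (leq_trans (leq_card_setU _ _)) // addSn binS leq_add //.
  by apply: IHk => z zc; apply: szN; apply: up_step zc.
rewrite addnS -addSn; apply: IHt => z zx.
have [lt_cz|le_zc] := ltnP (rk c) (rk z); last first.
  rewrite (_ : [set _ | _ ] = set0) ?cards0 //; apply/setP=> y; rewrite !inE.
  by apply/andP=> -[/rk_up]; lia.
rewrite -ltnS (leq_trans _ (szN z zx)) // [leqRHS](cardsD1 c) inE nc.
rewrite (low_N _ _ zx lt_cz) add1n ltnS subset_leq_card //.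
apply/subsetP=> y; rewrite !inE => /andP[-> lt_cy]; rewrite (leq_trans nc) 1?ltnW //.
by rewrite !andbT; apply: contraTneq lt_cy => ->; rewrite ltnn.
Qed.

Lemma card_up t k x : (forall z, #|[set c | N z c]| <= t) -> #|up k x| <= 'C(k + t, t).
Proof.
move=> szN; rewrite (_ : up k x = [set b in up k x | 0 <= rk b]).
  apply: card_up_above => z _; rewrite (leq_trans _ (szN z)) // subset_leq_card //.
  by apply/subsetP=> c; rewrite !inE => /andP[].
by apply/setP=> b; rewrite inE andbT.
Qed.

(** * The elimination tree and the tree decomposition it carries *)

Definition up_parent (x : X) : option X :=
  if [pick c | N x c] is Some c0 then Some [arg max_(c > c0 | N x c) rk c] else None.

Variant up_parent_spec x : option X -> Prop :=
| UpParent c of N x c & (forall d, N x d -> rk d <= rk c) : up_parent_spec x (Some c)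
| UpRoot of (forall d, ~~ N x d) : up_parent_spec x None.

Lemma up_parentP x : up_parent_spec x (up_parent x).
Proof.
rewrite /up_parent; case: pickP => [c0 Nc0|noN].
  by case: arg_maxnP => // c Nc maxc; constructor.
by constructor=> d; rewrite noN.
Qed.

(* The extra node [None] joins the elimination forest into one tree. *)
Definition up_tree : rel (option X) := fun a b =>
  (if a is Some x then up_parent x == b else false) ||
  (if b is Some x then up_parent x == a else false).

Lemma up_tree_sgraph : sgraph up_tree.
Proof.
split=> [a b|a]; first by rewrite /up_tree orbC.
rewrite /up_tree orbb; case: a => // x; case: up_parentP => // c Nxc _.
by apply/eqP=> -[eq_cx]; move: (rk_up Nxc); rewrite eq_cx ltnn.
Qed.

Lemma up_tree_root a : connect up_tree a None.
Proof.
case: a => [x|]; last exact: connect0.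
have [n] := ubnP (rk x); elim: n x => // n IH x le_xn.
have: up_tree (Some x) (up_parent x) by rewrite /up_tree eqxx.
case: up_parentP => [c Nxc _|_] step; last exact: connect1.
apply: connect_trans (connect1 step) (IH c _).
by rewrite (leq_trans (rk_up Nxc)).
Qed.

(* On a cycle, a vertex of largest rank would have two distinct parents. *)
Lemma up_tree_is_tree : is_tree up_tree.
Proof.
have sym := up_tree_sgraph.1.
split; first exact: up_tree_sgraph.
split; first by apply/card_gt0P; exists None.
split=> [a b|[s /and3P[sz_s Us cyc_s]]].
  apply: connect_trans (up_tree_root a) _.
  by rewrite (sym_connect_sym sym) up_tree_root.
(* The shift by one gives [None] a smaller weight than every vertex. *)
pose w (a : option X) := if a is Some x then (rk x).+1 else 0.
have [a a_s maxa] : exists2 a, a \in s & {in s, forall b, w b <= w a}.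
  case: s sz_s {Us cyc_s} => [//|a0 s] _.
  case: (@arg_maxnP _ a0 (mem (a0 :: s)) w); first exact: mem_head.
  by move=> a a_s maxa; exists a => // b /maxa.
have up_only b : b \in s -> up_tree a b -> exists2 x, a = Some x & up_parent x = b.
  move=> /maxa le_ba; case/orP; first by case: a {a_s maxa le_ba} => // x /eqP; exists x.
  case: b le_ba => // y le_ya /eqP; case: up_parentP => [c Nyc _|_] eq_a.
    by move: le_ya (rk_up Nyc); rewrite -eq_a /=; lia.
  by rewrite -eq_a in le_ya.
(* Once the cycle is rotated to start at [a], its second vertex [b] and last vertex [c] are the two
   neighbours of [a], distinct because of the length. *)
have [i s' rot_s] := rot_to a_s.
have mem_s b : (b \in s) = (b \in a :: s') by rewrite -rot_s mem_rot.
move: cyc_s Us sz_s; rewrite -(rot_cycle i) -(rot_uniq i) -(size_rot i) rot_s.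
case: s' {rot_s} mem_s => [//|b s'] mem_s; case/lastP: s' mem_s => [//|s' c] mem_s.
rewrite /= rcons_path last_rcons => /andP[ab /andP[_ ca]] /and3P[_ + _] _.
rewrite sym in ca.
have [|//|x eqa xb] := up_only b; first by rewrite mem_s !inE eqxx orbT.
have [|//|y eqa' yc] := up_only c; first by rewrite mem_s !inE mem_rcons mem_head !orbT.
have eq_xy : x = y by move: eqa'; rewrite eqa => -[].
by rewrite -xb eq_xy yc mem_rcons mem_head.
Qed.

(** The parent is the lowest up-neighbour, so by [up_neighbour] it reaches everything that [x]
    reaches besides [x] itself. *)
Lemma up_parent_up k x b : b \in up k x -> b != x ->
  exists2 c, up_parent x = Some c & N x c /\ b \in up k c.
Proof.
case: k => [|k]; first by rewrite inE => ->.
move=> bx nbx; case/upSP: (bx) => [eqbx|[d Nxd bd]]; first by rewrite eqbx eqxx in nbx.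
case: up_parentP => [c Nxc maxc|/(_ d)]; last by rewrite Nxd.
exists c => //; split=> //; apply: (up_neighbour Nxc bx).
exact: leq_trans (up_rk bd) (maxc d Nxd).
Qed.

Definition up_bag (J : finType) (h : J -> X) k (a : option X) : {set J} :=
  if a is Some x then [set j | h j \in up k x] else set0.

(** The nodes whose bags hold [j] form a subtree with top [h j]: by [up_parent_up], the parent of
    any other such node is again one. *)
Lemma up_tree_decomposition (J : finType) (eJ : rel J) (h : J -> X) k :
  (forall i j, eJ i j -> exists z, (h i \in up k z) && (h j \in up k z)) ->
  tree_decomposition eJ up_tree (up_bag h k).
Proof.
move=> cov; split; first exact: up_tree_is_tree.
split=> [j|]; first by exists (Some (h j)); rewrite inE up_refl.
split=> [i j /cov[z zP]|j a b ja jb]; first by exists (Some z); rewrite !inE.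
set R := [rel _ _ | _].
have R_sym : connect_sym R.
  apply: sym_connect_sym => a' b' /=; rewrite (up_tree_sgraph.1) /=.
  by congr (_ && _); rewrite andbC.
suff to_top c : j \in up_bag h k c -> connect R c (Some (h j)).
  by apply: connect_trans (to_top a ja) _; rewrite R_sym; apply: to_top.
case: c => [x|]; last by rewrite inE.
have [n] := ubnP (rk x); elim: n x => // n IH x le_xn jx.
have [<-|neq] := eqVneq (h j) x; first exact: connect0.
have jx' : h j \in up k x by rewrite inE in jx.
have [c pxc [Nxc jc]] := up_parent_up jx' neq.
apply: (@connect_trans _ _ (Some c)); last first.
  by apply: IH; rewrite ?inE // (leq_trans (rk_up Nxc)).
by apply: connect1; rewrite /= !inE jx' jc /up_tree pxc eqxx.
Qed.

Lemma up_treewidth (J : finType) (eJ : rel J) (h : J -> X) k t :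
  injective h -> (forall z, #|[set c | N z c]| <= t) ->
  (forall i j, eJ i j -> exists z, (h i \in up k z) && (h j \in up k z)) ->
  treewidth_le eJ ('C(k + t, t) - 1).
Proof.
move=> inj_h szN cov; exists (option X), up_tree, (up_bag h k).
split=> [|[x|]]; first exact: up_tree_decomposition.
  (* Positivity makes the truncated subtraction exact. *)
  have C_gt0 : 0 < 'C(k + t, t) by rewrite bin_gt0 leq_addl.
  rewrite subn1 prednK // (leq_trans _ (card_up k x szN)) //.
  rewrite -(card_imset _ inj_h) subset_leq_card //.
  by apply/subsetP=> y /imsetP[j]; rewrite inE => jx ->.
by rewrite cards0.
Qed.

End UpReach.

(** * From a tree decomposition to an elimination order *)

Lemma descent_to_root (I : finType) (tr : rel I) (r : I) :
  (forall i, connect tr i r) ->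
  exists D : I -> nat, forall i, i != r -> exists2 j, tr i j & D j < D i.
Proof.
move=> conn; pose walk i n := [exists s : n.-tuple I, path tr i s && (last i s == r)].
have ex_walk i : exists n, walk i n.
  have /connectP[p pp lp] := conn i; exists (size p); apply/existsP.
  by exists (in_tuple p); rewrite pp lp eqxx.
exists (fun i => ex_minn (ex_walk i)) => i nir.
case: ex_minnP => -[|n] /existsP[s /andP[ps ls]] _.
  by move: ls nir; rewrite tuple0 /= => ->.
case/tupleP: s => j s in ps ls *; move: ps => /= /andP[ij ps].
exists j => //; case: ex_minnP => m _ min_m; rewrite ltnS.
by apply: min_m; apply/existsP; exists s; rewrite ps.
Qed.

(** A path around the edge, closed up by it, would be a cycle; it has at least three vertices,
    because a one-edge path would be the removed edge. Comparing sets removes both orientations. *)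
Lemma tree_edge_bridge (I : finType) (tr : rel I) (a b : I) : is_tree tr -> tr a b ->
  ~~ connect [rel x y | tr x y && ([set x; y] != [set a; b])] a b.
Proof.
case=> -[sym irr] [_ [_ acyclic]] ab; apply/negP=> /connectP[p0 pp0 lp0].
case/shortenP: pp0 lp0 => p pp Up _ lp; apply: acyclic; exists (a :: p).
have tr_p : path tr a p by apply: sub_path pp => x y /= /andP[].
rewrite Up /= rcons_path tr_p -lp sym ab !andbT.
case: p pp {Up tr_p} lp => [|c [|//]] /=.
  by move=> _ eq_ba; rewrite eq_ba irr in ab.
by move=> + eq_bc; rewrite -eq_bc eqxx !andbF.
Qed.

Section TopBags.

Variables (V : finType) (e : rel V) (I : finType) (tr : rel I) (B : I -> {set V}).
Hypothesis td : tree_decomposition e tr B.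
Variables (r : I) (D : I -> nat).
Hypothesis descent : forall i, i != r -> exists2 j, tr i j & D j < D i.

(* Otherwise the first edge from [a] towards [r] would be bypassed: from [a] inside the
   bags of [v] to [i], inside the bags of [w] to [b], and from [b] to [r]. *)
Lemma mem_top_bag v w i a b : v \in B i -> w \in B i ->
  v \in B a -> (forall j, v \in B j -> D a <= D j) ->
  w \in B b -> D b <= D a -> w \in B a.
Proof.
case: td => tree [_ [_ conn]] vi wi va min_a wb le_ba.
apply/negPn/negP=> wNa.
have [eq_ar|nar] := eqVneq a r.
  have r_min c : D r <= D c.
    have [n] := ubnP (D c); elim: n c => // n IH c le_cn.
    have [->//|/descent[q _ lt_qc]] := eqVneq c r.
    by apply: leq_trans (ltnW lt_qc); apply: IH; apply: leq_trans lt_qc _.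
  have [eq_br|/descent[j _ lt_jb]] := eqVneq b r; first by rewrite eq_ar -eq_br wb in wNa.
  by move: (r_min j) le_ba; rewrite eq_ar; lia.
have [p ap lt_pa] := descent nar.
set R := [rel x y | tr x y && ([set x; y] != [set a; p])].
have tr_sym : symmetric tr by case: tree => -[].
have R_sym : connect_sym R.
  by apply: sym_connect_sym => x y /=; rewrite tr_sym setUC.
have avoid x y : tr x y -> x != a -> y != a -> R x y.
  move=> xy nxa nya; rewrite /= xy; apply/eqP=> /setP/(_ a).
  by rewrite !inE eqxx eq_sym (negPf nxa) eq_sym (negPf nya).
(* [D] decreases strictly along the descent from [c], so the descent never meets [a]. *)
have to_root c : D c <= D a -> c != a -> connect R c r.
  have [n] := ubnP (D c); elim: n c => // n IH c le_cn le_ca nca.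
  have [->|/descent[q cq lt_qc]] := eqVneq c r; first exact: connect0.
  have nqa : q != a by apply: contraTneq lt_qc => ->; rewrite -leqNgt.
  apply: (@connect_trans _ _ q); last by apply: IH; rewrite ?nqa; lia.
  by apply: connect1; apply: avoid.
(* [p] is nearer to [r] than every bag containing [v], so a walk inside those bags does not use the
   edge from [a] to [p]. *)
have ai : connect R a i.
  apply: connect_sub (conn v a i va vi) => x y /= /and3P[xy vx vy].
  apply: connect1; rewrite /= xy; apply/eqP=> /setP/(_ p).
  rewrite !inE eqxx orbT => /orP[]/eqP eqp; subst p.
    by move: (min_a _ vx); rewrite leqNgt lt_pa.
  by move: (min_a _ vy); rewrite leqNgt lt_pa.
have ib : connect R i b.
  apply: connect_sub (conn w i b wi wb) => x y /= /and3P[xy wx wy].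
  by apply: connect1; apply: avoid => //; apply: contraNneq wNa => <-.
have nba : b != a by apply: contraNneq wNa => <-.
have npa : p != a by apply: contraTneq lt_pa => ->; rewrite ltnn.
case/negP: (tree_edge_bridge tree ap).
apply: connect_trans ai (connect_trans ib (connect_trans (to_root b le_ba nba) _)).
by rewrite R_sym; apply: to_root npa; apply: ltnW.
Qed.

End TopBags.

(** Vertices are ranked by the depth of their topmost bag. Of two vertices sharing a bag, the one of
    larger rank has the other in its topmost bag by [mem_top_bag]; this gives the cliques and the
    edges. That bag also holds the vertex itself, which leaves at most [t] up-neighbours. *)
Lemma treewidth_elimination_order (X : finType) (eX : rel X) (t : nat) :
  treewidth_le eX t -> exists (rk : X -> nat) (N : rel X),
    [/\ elimination_order rk N,
        forall x, #|[set c | N x c]| <= t &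
        forall x y, eX x y -> [|| x == y, N x y | N y x]].
Proof.
case=> I [tr [B [td szB]]]; have [tree [cover [edges conn]]] := td.
have [_ [/card_gt0P[r _] [tr_conn _]]] := tree.
have [D descent] := descent_to_root (fun i => tr_conn i r).
have /fin_all_exists[top topP] : forall v, exists a,
    v \in B a /\ forall j, v \in B j -> D a <= D j.
  move=> v; have [i vi] := cover v.
  by case: (@arg_minnP _ i [pred j | v \in B j] D vi) => a va min_a; exists a.
(* In base [#|X|] the depth is the leading part and [enum_rank] breaks ties. *)
pose rk v := D (top v) * #|X| + enum_rank v.
have rk_div v : rk v %/ #|X| = D (top v).
  have := ltn_ord (enum_rank v) => lt_v.
  by rewrite /rk divnMDl ?(leq_trans _ lt_v) // divn_small ?addn0.
have rk_inj : injective rk.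
  move=> v w eq_vw; have := rk_div v; rewrite eq_vw rk_div => eqD.
  by move: eq_vw; rewrite /rk eqD => /addnI/ord_inj/enum_rank_inj.
have mem_top v w i : v \in B i -> w \in B i -> rk w < rk v -> w \in B (top v).
  move=> vi wi lt_wv; have [va min_a] := topP v; have [wb _] := topP w.
  apply: (mem_top_bag td descent vi wi va min_a wb).
  by rewrite -!rk_div; apply: leq_div2r; apply: ltnW.
exists rk, [rel v w | (w \in B (top v)) && (rk w < rk v)]; split.
- split=> // [x c /= /andP[]//|x c c' /= /andP[cx _] /andP[c'x _] lt_cc'].
  by rewrite lt_cc' (mem_top _ _ _ cx c'x lt_cc').
- move=> x; rewrite -ltnS (leq_trans _ (szB (top x))) //.
  rewrite [leqRHS](cardsD1 x) (topP x).1 add1n ltnS subset_leq_card //.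
  apply/subsetP=> c; rewrite !inE /= => /andP[-> lt_cx]; rewrite andbT.
  by apply: contraTneq lt_cx => ->; rewrite ltnn.
- move=> x y /edges[i /andP[xi yi]] /=.
  case: (ltngtP (rk x) (rk y)) => [lt_xy|lt_yx|/rk_inj->]; last by rewrite eqxx.
    by rewrite (mem_top _ _ _ yi xi lt_xy) !orbT.
  by rewrite (mem_top _ _ _ xi yi lt_yx) !orbT.
Qed.

(** * Rerouting vertices along shortcuts *)

Lemma internal_rcons (T : Type) (x : T) s y : internal (x :: rcons s y) = s.
Proof. by rewrite /internal /= size_rcons /= -cats1 take_size_cat // drop0. Qed.

Section Reroute.

Variables (k : nat) (T X : finType) (e : rel T) (f : T -> X) (P : seq (seq T)).
Hypothesis k_gt0 : 0 < k.
Hypothesis e_sym : symmetric e.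
Hypothesis paths : forall p, p \in P -> is_gpath e p /\ 2 <= size p <= k.+1.

Lemma shortcut_sym : symmetric (shortcut_graph e P).
Proof.
move=> v w; rewrite /shortcut_graph e_sym; congr (_ || _).
by apply: eq_has => -[|x q] //=; rewrite orbC.
Qed.

(** A shortcut can be walked from either end; its interior is matched only as a set, since reversal
    changes the order. *)
Lemma shortcut_walk p v w : p \in P -> ends_at p v w ->
  exists s, [/\ path e v (rcons s w), s =i internal p & size s < k].
Proof.
move=> /paths[]; case: p => [//|x q] [_ pq] sz.
case/lastP: q => [|s y] in pq sz *; first by [].
rewrite internal_rcons /= last_rcons; move: sz; rewrite /= size_rcons => /andP[_ sz].
case/orP=> /andP[/eqP<- /eqP<-]; first by exists s.
exists (rev s); split; [|by move=> z; rewrite mem_rev|by rewrite size_rev].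
have := rev_path e x (rcons s y); rewrite last_rcons belast_rcons rev_cons => ->.
by rewrite (eq_path (e' := e)) // => a b; rewrite e_sym.
Qed.

Lemma internal_size p : p \in P -> size (internal p) < k.
Proof.
by move=> /paths[_ /andP[_ sz]]; rewrite /internal size_drop size_takel ?leq_pred //; lia.
Qed.

Definition is_end (p : seq T) (v : T) := [exists w, ends_at p v w].

Definition mates (v : T) : {set T} :=
  [set u | has (fun p => (u \in internal p) && is_end p v) P].

Lemma matesP v u :
  reflect (exists p w, [/\ p \in P, u \in internal p & ends_at p v w]) (u \in mates v).
Proof.
rewrite inE; apply: (iffP hasP) => [[p pP /andP[up /existsP[w pvw]]]|[p [w [pP up pvw]]]].
  by exists p, w.
by exists p; rewrite // up; apply/existsP; exists w.
Qed.

Variables (rk : X -> nat) (N : rel X).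
Hypothesis elimN : elimination_order rk N.
Hypothesis f_step : forall v w, e v w -> weak_step N (f v) (f w).

Definition reroute (v : T) : X := [arg min_(x < f v in f v |: f @: mates v) rk x].

Lemma rerouteP v :
  [/\ reroute v = f v \/ exists2 u, u \in mates v & reroute v = f u,
      rk (reroute v) <= rk (f v) &
      forall u, u \in mates v -> rk (reroute v) <= rk (f u)].
Proof.
rewrite /reroute; case: arg_minnP => [|x]; first exact: setU11.
move=> /setU1P x_in min_x; split; last 2 first.
- by apply: min_x; apply: setU11.
- by move=> u uv; apply: min_x; apply: setU1r; apply: imset_f.
- by case: x_in => [|/imsetP]; [left|right].
Qed.

Lemma walk_up v s u : path e v (rcons s u) ->
  {in v :: s, forall y, rk (f u) <= rk (f y)} -> f u \in up N (size s).+1 (f v).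
Proof.
move=> ps min_u; have := @up_walk _ _ _ elimN (f v) (map f (rcons s u)).
rewrite last_map last_rcons size_map size_rcons; apply.
  by rewrite path_map; apply: sub_path ps => a b /f_step.
move=> y; rewrite -map_cons => /mapP[z]; rewrite -rcons_cons mem_rcons inE.
by case/predU1P=> [->->//|zs ->]; apply: min_u.
Qed.

(** The walk from [v] along a shortcut stops at an interior vertex, hence after at most [k - 1]
    edges. Its vertices after [v] are mates of [v], so none lies in a part above the chosen one. *)
Lemma reroute_up v : reroute v \in up N k.-1 (f v).
Proof.
have [[->|[u uv gu]] min_v min_m] := rerouteP v; first exact: up_refl.
have /matesP[p [w [pP up pvw]]] := uv.
have [s [ps eq_s sz]] := shortcut_walk pP pvw.
rewrite gu in min_v min_m *; move: up; rewrite -eq_s => us.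
have s_mates z : z \in s -> z \in mates v.
  by rewrite eq_s => zp; apply/matesP; exists p, w.
case/splitPr: us => s1 s2 in ps s_mates sz {eq_s}.
rewrite -cat1s catA cats1 rcons_cat cat_path in ps.
have {}sz : size s1 < k.-1.
  by rewrite -ltnS prednK // (leq_trans _ sz) // size_cat addnS !ltnS leq_addr.
apply: (up_mono sz).
apply: walk_up => [|y]; first by case/andP: ps.
rewrite inE => /predU1P[->//|ys1]; apply: min_m; apply: s_mates.
by rewrite mem_cat ys1.
Qed.

Lemma reroute_up_top p v w u : p \in P -> ends_at p v w -> u \in internal p ->
  {in internal p, forall y, rk (f u) <= rk (f y)} -> reroute v \in up N k (f u).
Proof.
move=> pP pvw up min_u; have [_ _ min_m] := rerouteP v.
have le_gu : rk (reroute v) <= rk (f u) by apply: min_m; apply/matesP; exists p, w.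
have [s [ps eq_s sz]] := shortcut_walk pP pvw.
have {}min_u : {in s, forall y, rk (f u) <= rk (f y)} by move=> y; rewrite eq_s => /min_u.
move: up; rewrite -eq_s => us.
case/splitPr: us => s1 s2 in ps min_u {eq_s sz}.
rewrite -cat1s catA cats1 rcons_cat cat_path in ps; case/andP: ps => ps _.
have min_s1 : {in s1, forall y, rk (f u) <= rk (f y)}.
  by move=> y ys; apply: min_u; rewrite mem_cat ys.
have gv := reroute_up v.
(* If [f v] is not above [f u], both [f u] and the new part are reached from [f v], and [up_between]
   applies. *)
have [le_uv|lt_vu] := leqP (rk (f u)) (rk (f v)).
  apply: (up_mono (j := k.-1)); first exact: leq_pred.
  apply: (up_between elimN _ gv le_gu); apply: walk_up ps _ => y.
  by rewrite inE => /predU1P[->|/min_s1].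
(* Otherwise the walk must begin with a step down from [f v] to some [x] that reaches [f u]. So
   [f v] is one up-step above [f u], which leaves [k - 1] up-steps for rerouting. *)
have [x Nxv ux] : exists2 x, N x (f v) & exists j, f u \in up N j x.
  have [_ rk_N _] := elimN.
  have first_step q : rk (f u) <= rk (f q) -> e v q -> N (f q) (f v).
    move=> le_uq /f_step/or3P[/eqP eqf|/rk_N lt_qv|//].
      by move: lt_vu; rewrite eqf ltnNge le_uq.
    by move: (leq_trans le_uq (ltnW lt_qv)); rewrite leqNgt lt_vu.
  case: s1 => [|q s1] in ps min_s1 {min_u} *.
    exists (f u); last by exists 0; apply: up_refl.
    by case/andP: ps => vu _; apply: first_step vu.
  case/andP: ps => vq ps; exists (f q).
    by apply: first_step vq; apply: min_s1; rewrite mem_head.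
  by exists (size s1).+1; apply: walk_up.
have [j ujx] := ux.
have vu : f v \in up N 1 (f u).
  apply: (up_between elimN ujx) (ltnW lt_vu).
  by apply: up_step Nxv _; apply: up_refl.
by rewrite -(prednK k_gt0) -add1n; apply: up_trans vu gv.
Qed.

Lemma reroute_edge v w : shortcut_graph e P v w ->
  exists z, (reroute v \in up N k z) && (reroute w \in up N k z).
Proof.
have in_edge a b : e a b ->
    exists z, (reroute a \in up N k z) && (reroute b \in up N k z).
  have self c : reroute c \in up N k (f c).
    by apply: up_mono (reroute_up c); apply: leq_pred.
  have nbr c x : N x (f c) -> reroute c \in up N k x.
    by move=> Nxc; rewrite -(prednK k_gt0); apply: up_step Nxc (reroute_up c).
  case/f_step/or3P=> [/eqP eqf|Nab|Nba].
  - by exists (f a); rewrite self eqf self.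
  - by exists (f a); rewrite self nbr.
  - by exists (f b); rewrite self nbr.
case/orP=> [/in_edge//|/hasP[p pP pvw]].
have [[|q s] [ps eq_s _]] := shortcut_walk pP pvw.
  (* A shortcut with empty interior is a single edge of [e]. *)
  by apply: in_edge; rewrite /= andbT in ps.
have qp : q \in internal p by rewrite -eq_s mem_head.
case: (@arg_minnP _ q (mem (internal p)) (rk \o f) qp) => u up min_u.
exists (f u); rewrite (reroute_up_top pP pvw up min_u).
rewrite (reroute_up_top (v := w) (w := v) pP _ up min_u) //.
by case: (p) pvw => //= x r; rewrite orbC.
Qed.

(** * Merged layers and the width bound *)

Variables (lay : T -> nat) (l : nat).
Hypothesis lay_e : layering e lay.

Lemma path_lay n v s : path e v s -> size s <= n ->
  (lay v <= lay (last v s) + n) && (lay (last v s) <= lay v + n).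
Proof.
elim: s n v => [|w s IH] n v /=; first by rewrite !leq_addr.
case: n => // n /andP[/lay_e/andP[h1 h2]] /IH{}IH /IH/andP[h3 h4].
by apply/andP; split; lia.
Qed.

(** The ends of a shortcut are at most [k] layers apart, and adding [k] raises the merged index by
    exactly one. *)
Lemma layering_shortcut : layering (shortcut_graph e P) (fun v => lay v %/ k).
Proof.
move=> v w vw.
have /andP[h1 h2] : (lay v <= lay w + k) && (lay w <= lay v + k).
  case/orP: vw => [/lay_e/andP[h1 h2]|/hasP[p pP pvw]]; first by apply/andP; split; lia.
  have [s [ps _ sz]] := shortcut_walk pP pvw.
  have := @path_lay k v (rcons s w) ps; rewrite last_rcons size_rcons; exact.
have divS m : (m + k) %/ k = (m %/ k).+1 by rewrite divnDr // divnn k_gt0 addn1.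
by rewrite -!divS !leq_div2r.
Qed.

Hypothesis width_l : forall i x, #|[set v | (lay v == i) && (f v == x)]| <= l.

Definition block i x := [set v | (lay v %/ k == i) && (f v == x)].

Lemma card_block i x : #|block i x| <= k * l.
Proof.
have sub : block i x \subset
    \bigcup_(m < k) [set v | (lay v == i * k + m) && (f v == x)].
  apply/subsetP=> v; rewrite inE => /andP[/eqP vi vx].
  apply/bigcupP; exists (Ordinal (ltn_pmod (lay v) k_gt0)) => //.
  by rewrite inE vx /= -vi -divn_eq eqxx.
rewrite (leq_trans (subset_leq_card sub)) // (leq_trans (card_bigcup_le _ _ _)) //.
apply: (@leq_trans (\sum_(m < k) l)); last by rewrite sum_nat_const card_ord.
by apply: leq_sum => m _; apply: width_l.
Qed.

Variable d : nat.
Hypothesis d_gt0 : 0 < d.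
Hypothesis deg_d : forall v, count (fun p => v \in internal p) P <= d.

Definition ends_via u : {set T} :=
  \bigcup_(p <- P | u \in internal p) [set v | is_end p v].

Lemma card_ends_via u : #|ends_via u| <= d * 2.
Proof.
rewrite (leq_trans (card_bigcup_le _ _ _)) //.
apply: (@leq_trans (\sum_(p <- P | u \in internal p) 2)).
  apply: leq_sum => p _; case: p => [|x q].
    rewrite (_ : [set _ | _] = set0) ?cards0 //.
    by apply/setP=> v; rewrite !inE; apply/existsP=> -[].
  apply: (@leq_trans #|[set x; last x q]|); last by rewrite cards2; case: eqP.
  apply: subset_leq_card; apply/subsetP=> v; rewrite !inE => /existsP[w] /=.
  by rewrite ![v == _]eq_sym; case/orP=> /andP[xv lv]; rewrite ?xv ?lv ?orbT.
by rewrite big_const_seq iter_addn_0 mulnC leq_mul2r deg_d.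
Qed.

(** The successor on the left expresses a difference of at most one without truncated
    subtraction. *)
Lemma mates_window v u : u \in mates v ->
  v \in ends_via u /\ (lay u %/ k).+1 \in [:: lay v %/ k; (lay v %/ k).+1; (lay v %/ k).+2].
Proof.
case/matesP=> p [w [pP up pvw]]; split.
  have pv : v \in [set v | is_end p v] by rewrite inE; apply/existsP; exists w.
  by rewrite /ends_via (big_rem p pP) /= up inE pv.
have [s [ps eq_s sz]] := shortcut_walk pP pvw.
move: up; rewrite -eq_s => us.
case/splitPr: us => s1 s2 in ps sz {eq_s}.
rewrite -cat1s catA cats1 rcons_cat cat_path in ps; case/andP: ps => ps _.
have := @path_lay k v (rcons s1 u) ps; rewrite last_rcons size_rcons.
have {}sz : size s1 < k by rewrite (leq_trans _ sz) // size_cat ltnS leq_addr.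
move=> /(_ sz)/andP[h1 h2].
have divS m : (m + k) %/ k = (m %/ k).+1 by rewrite divnDr // divnn k_gt0 addn1.
have h3 : lay u %/ k <= (lay v %/ k).+1 by rewrite -divS leq_div2r; lia.
have h4 : lay v %/ k <= (lay u %/ k).+1 by rewrite -divS leq_div2r; lia.
by rewrite !inE; lia.
Qed.

Lemma card_reroute_block i x :
  #|[set v | (lay v %/ k == i) && (reroute v == x)]| <= d * l * (k ^ 3 + 3 * k).
Proof.
set S := [set v | _].
pose W := block i.-1 x :|: block i x :|: block i.+1 x.
have szW : #|W| <= 3 * (k * l).
  have := leq_card_setU (block i.-1 x :|: block i x) (block i.+1 x).
  have := leq_card_setU (block i.-1 x) (block i x).
  have := card_block i.-1 x; have := card_block i x; have := card_block i.+1 x.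
  by rewrite /W; move=> h1 h2 h3 [h4 _] [h5 _]; lia.
have sub : S \subset block i x :|: \bigcup_(u in W) ends_via u.
  apply/subsetP=> v; rewrite inE => /andP[vi /eqP vx]; apply/setUP.
  have [[gv|[u uv gu]] _ _] := rerouteP v.
    by left; rewrite inE vi -gv vx eqxx.
  right; have [vu win] := mates_window uv; apply/bigcupP; exists u => //.
  by move: win; rewrite !inE -gu vx eqxx (eqP vi); lia.
(* Vertices keeping their part lie in one block; the others are ends of shortcuts through [W]. For
   [k = 1] no shortcut has an interior, hence the factor [k > 1]. *)
have szS : #|S| <= k * l + (k > 1) * (3 * (k * l) * (d * 2)).
  rewrite (leq_trans (subset_leq_card sub)) // (leq_trans (leq_card_setU _ _)) //.
  rewrite leq_add ?card_block // (leq_trans (card_bigcup_le _ _ _)) //.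
  have [k_gt1|k_le1] := ltnP 1 k.
    rewrite mul1n; apply: (@leq_trans (\sum_(u in W) d * 2)).
      by apply: leq_sum => u _; apply: card_ends_via.
    by rewrite sum_nat_const leq_mul2r szW orbT.
  rewrite big1 // => u _; apply/eqP; rewrite cards_eq0; apply/eqP.
  rewrite /ends_via big1_seq // => p /andP[up pP].
  have := internal_size pP; move: up; case: (internal p) => //= q s _; lia.
apply: leq_trans szS _; have le_kl : k * l <= k * l * d by rewrite leq_pmulr.
have [k_gt1|k_le1] := ltnP 1 k.
  (* With [4 * k <= k ^ 3], the total is at most [7 * k * l * d], which is within the bound. *)
  have le_k : 2 ^ 2 * k <= k ^ 3 by rewrite (expnSr k) leq_mul2r leq_exp2r // k_gt1 orbT.
  apply: (@leq_trans (d * l * (2 ^ 2 * k + 3 * k))); last by rewrite leq_mul2l leq_add2r le_k orbT.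
  by rewrite mul1n; nia.
by rewrite mul0n addn0 (leq_trans le_kl) //; nia.
Qed.

End Reroute.

Theorem theorem11 (t l k d : nat) (ht : 0 < t) (hl : 0 < l) (hk : 0 < k) (hd : 0 < d)
    (T : finType) (e : rel T) (X : finType) (eH : rel X) (f : T -> X)
    (P : seq (seq T)) :
  sgraph e -> sgraph eH ->
  is_H_partition e eH f -> layered_width_le e f l -> treewidth_le eH t ->
  shortcut_system e k d P ->
  exists (J : finType) (eJ : rel J) (g : T -> J),
    [/\ sgraph eJ,
        treewidth_le eJ ('C(k + t, t) - 1),
        is_H_partition (shortcut_graph e P) eJ g &
        layered_width_le (shortcut_graph e P) g (d * l * (k ^ 3 + 3 * k))].
Proof.
move=> [e_sym _] _ [_ quotient] [lay [lay_e width_l]] twH [_ [_ [paths deg_d]]].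
have [rk [N [elimN szN edges]]] := treewidth_elimination_order twH.
have f_step v w : e v w -> weak_step N (f v) (f w).
  move=> vw; have [eqf|neqf] := eqVneq (f v) (f w); first by rewrite /weak_step eqf eqxx.
  by apply: edges; apply/quotient; split=> //; exists v, w.
(* Rerouting can empty a part, so [J] keeps only the image of [g], which makes [gJ] surjective. *)
pose g := reroute f P rk; pose J := {x : X | x \in codom g}.
pose gJ (v : T) : J := exist _ (g v) (codom_f g v).
have val_gJ v : val (gJ v) = g v by [].
have G_sym := shortcut_sym P e_sym.
pose eJ : rel J := fun x y => (x != y) &&
  [exists v, exists w, [&& gJ v == x, gJ w == y & shortcut_graph e P v w]].
have eJP x y : eJ x y <->
    (x != y /\ exists v w : T, [/\ gJ v = x, gJ w = y & shortcut_graph e P v w]).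
  split=> [/andP[nxy /existsP[v /existsP[w /and3P[/eqP gv /eqP gw vw]]]]|].
    by split=> //; exists v, w.
  case=> nxy [v [w [gv gw vw]]]; rewrite /eJ nxy; apply/existsP; exists v.
  by apply/existsP; exists w; rewrite gv gw !eqxx.
exists J, eJ, gJ; split.
- split=> [x y|x]; last by rewrite /eJ eqxx.
  by apply/idP/idP=> /eJP[nxy [v [w [gv gw vw]]]]; apply/eJP; rewrite eq_sym;
    split=> //; exists w, v; rewrite G_sym.
- apply: (up_treewidth elimN val_inj szN) => x y /eJP[_ [v [w [<- <- vw]]]].
  by rewrite !val_gJ; apply: (reroute_edge hk e_sym paths elimN f_step).
- split=> // -[x x_g]; have /codomP[v eqx] := x_g; exists v.
  by apply: val_inj; rewrite val_gJ -eqx.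
- exists (fun v => lay v %/ k).
  split; first exact: (layering_shortcut hk e_sym paths lay_e).
  move=> i x.
  have := card_reroute_block hk e_sym paths rk lay_e width_l hd deg_d i (val x).
  apply: leq_trans; apply: subset_leq_card.
  by apply/subsetP=> v; rewrite !inE => /andP[-> /eqP<-]; rewrite eqxx.
Qed.
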